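(* For every integer $n\ge 3$, \[ \overline{\mathrm{lcr}}(K_n) \le \begin{cases} \frac{1}{9}(n-3)^2 & \text{if } n \equiv 0 \pmod 3,\\ \frac{1}{9}(n-1)(n-4) & \text{if } n \equiv 1 \pmod 3,\\ \frac{1}{9}(n-2)^2 & \text{if } n \equiv 2 \pmod 3.\end{cases} \]
   Context: A rectilinear drawing of the complete graph $K_n$ consists of $n$ points in the plane in general position (no three collinear), the vertices, with every pair of vertices joined by the straight line segment between them, the edges. Two edges cross if their segments intersect at a point that is not a common endpoint. The local crossing number of a drawing is the largest number of edges crossing any single edge of the drawing. The rectilinear local crossing number $\overline{\mathrm{lcr}}(K_n)$ is the minimum of the local crossing number over all rectilinear drawings of $K_n$. *)

(* Defs.v *)
From mathcomp Require Import all_boot all_order all_algebra.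
From mathcomp Require Import boolp reals.
From mathcomp Require Import ring.

Set Implicit Arguments.
Unset Strict Implicit.
Unset Printing Implicit Defensive.

Import Order.TTheory GRing.Theory Num.Theory.

Local Open Scope ring_scope.

Definition collinear (R : realType) (P Q S : R * R) : Prop :=
  exists a b c : R, (a, b) <> (0, 0) /\
    [/\ a * P.1 + b * P.2 = c, a * Q.1 + b * Q.2 = c & a * S.1 + b * S.2 = c].

Definition in_segment (R : realType) (P Q X : R * R) : Prop :=
  exists t : R, 0 <= t <= 1 /\
    X = ((1 - t) * P.1 + t * Q.1, (1 - t) * P.2 + t * Q.2).

(* A rectilinear drawing of K_n is determined by the positions of its
   vertices.  Injectivity follows from the second condition when 3 <= n. *)
Definition rectilinear_drawing (R : realType) (n : nat)
    (p : 'I_n -> R * R) : Prop :=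
  injective p /\
  forall i j k : 'I_n, i != j -> j != k -> i != k ->
    ~ collinear (p i) (p j) (p k).

(* The unordered edge {i, j} is encoded by the pair (i, j) with i < j. *)
Definition edges (n : nat) : {set 'I_n * 'I_n} :=
  [set e : 'I_n * 'I_n | (e.1 < e.2)%N]%SET.

Definition on_edge (R : realType) (n : nat) (p : 'I_n -> R * R)
    (e : 'I_n * 'I_n) (X : R * R) : Prop :=
  in_segment (p e.1) (p e.2) X.

Definition endpoint (R : realType) (n : nat) (p : 'I_n -> R * R)
    (e : 'I_n * 'I_n) (X : R * R) : Prop :=
  X = p e.1 \/ X = p e.2.

Definition cross (R : realType) (n : nat) (p : 'I_n -> R * R)
    (e f : 'I_n * 'I_n) : Prop :=
  e <> f /\ exists X : R * R,
    [/\ on_edge p e X, on_edge p f X & ~ (endpoint p e X /\ endpoint p f X)].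

Definition crossings (R : realType) (n : nat) (p : 'I_n -> R * R)
    (e : 'I_n * 'I_n) : nat :=
  #|[set f in edges n | `[< cross p e f >]]%SET|.

Definition local_crossing_number (R : realType) (n : nat)
    (p : 'I_n -> R * R) : nat :=
  (\max_(e in edges n) crossings p e)%N.

Definition lcr_attained (R : realType) (n : nat) : pred nat := fun k =>
  `[< exists p : 'I_n -> R * R,
        rectilinear_drawing p /\ local_crossing_number p = k >].

Lemma rectilinear_drawing_exists (R : realType) (n : nat) :
  exists p : 'I_n -> R * R, rectilinear_drawing p.
Proof.
exists (fun i : 'I_n => ((i : nat)%:R, (i : nat)%:R ^+ 2)).
have neqR (i j : 'I_n) : i != j -> ((i : nat)%:R - (j : nat)%:R : R) != 0.
  by move=> ij; rewrite subr_eq0 eqr_nat.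
split=> [i j [/eqP ij _]|i j k /neqR ij /neqR jk /neqR ik].
  by apply/val_inj/eqP; rewrite eqr_nat in ij.
move=> [a [b [c [ab0 [/= hi hj hk]]]]]; apply: ab0.
set x : R := (i : nat)%:R in ij ik hi *.
set y : R := (j : nat)%:R in ij jk hj *.
set z : R := (k : nat)%:R in jk ik hk *.
have h1 : (x - y) * (a + b * (x + y)) = 0.
  by rewrite -(subrr c) -{1}hi -hj; ring.
have h2 : (y - z) * (a + b * (y + z)) = 0.
  by rewrite -(subrr c) -{1}hj -hk; ring.
move/eqP: h1; rewrite mulf_eq0 (negPf ij) /= => /eqP h1.
move/eqP: h2; rewrite mulf_eq0 (negPf jk) /= => /eqP h2.
have : (x - z) * b = 0 by rewrite -(subrr 0) -{1}h1 -h2; ring.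
move/eqP; rewrite mulf_eq0 (negPf ik) /= => /eqP b0.
by move: h1; rewrite b0 mul0r addr0 => ->.
Qed.

Lemma lcr_attained_ex (R : realType) (n : nat) : exists k, lcr_attained R n k.
Proof.
have [p hp] := rectilinear_drawing_exists R n.
by exists (local_crossing_number p); apply/asboolP; exists p.
Qed.

Definition rectilinear_lcr (R : realType) (n : nat) : nat :=
  ex_minn (lcr_attained_ex R n).

(* Main.v *)
(* Vertex i lies on arm i mod 3 at rank i / 3.  The arms go from near the origin
   towards three directions permuted by a linear map of order 3, and each arm
   is slightly bent, so that a line through two vertices of an arm separates
   the other two arms.  This determines the orientation of every triple, hence
   which edges cross.  An edge with both ends on arm A, with m vertices of A
   strictly between them, is crossed only by edges from these m vertices to the
   rest of A or to the next arm.  An edge from the vertex of rank x of A to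
   the vertex of rank y of the next arm B is crossed only by edges A-B that
   reverse the order of ranks and by edges of A spanning x.  In both cases
   AM-GM bounds the number of crossings by (|A| + |B| - 2)^2 / 4, and
   |A| + |B| <= n - floor (n / 3). *)
Require Import Defs.
From mathcomp Require Import all_boot all_order all_algebra.
From mathcomp Require Import boolp reals.
From mathcomp Require Import ring lra zify.

Set Implicit Arguments.
Unset Strict Implicit.
Unset Printing Implicit Defensive.

Import Order.TTheory GRing.Theory Num.Theory.

Local Open Scope ring_scope.

(** * Orientation of triples and crossing of segments *)

(** Twice the signed area of the triangle, positive when it is counterclockwise. *)
Definition det3 (R : realType) (P Q S : R * R) : R :=
  (Q.1 - P.1) * (S.2 - P.2) - (Q.2 - P.2) * (S.1 - P.1).

Lemma det3_cycle (R : realType) (P Q S : R * R) : det3 P Q S = det3 Q S P.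
Proof. by rewrite /det3; ring. Qed.

Lemma det3_swap (R : realType) (P Q S : R * R) : det3 Q P S = - det3 P Q S.
Proof. by rewrite /det3; ring. Qed.

Lemma collinear_det3 (R : realType) (P Q S : R * R) :
  collinear P Q S -> det3 P Q S = 0.
Proof.
move=> [a [b [c [ab0 [hP hQ hS]]]]].
have ha : a * det3 P Q S = 0.
  have -> : a * det3 P Q S =
    (a * Q.1 + b * Q.2 - (a * P.1 + b * P.2)) * (S.2 - P.2)
    - (a * S.1 + b * S.2 - (a * P.1 + b * P.2)) * (Q.2 - P.2).
    by rewrite /det3; ring.
  by rewrite hP hQ hS subrr !mul0r subrr.
have hb : b * det3 P Q S = 0.
  have -> : b * det3 P Q S =
    (a * S.1 + b * S.2 - (a * P.1 + b * P.2)) * (Q.1 - P.1)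
    - (a * Q.1 + b * Q.2 - (a * P.1 + b * P.2)) * (S.1 - P.1).
    by rewrite /det3; ring.
  by rewrite hP hQ hS subrr !mul0r subrr.
apply/eqP/negPn/negP => d0; apply: ab0.
by move/eqP: ha; move/eqP: hb; rewrite !mulf_eq0 (negPf d0) !orbF => /eqP-> /eqP->.
Qed.

Lemma in_segmentC (R : realType) (P Q X : R * R) :
  in_segment P Q X -> in_segment Q P X.
Proof.
move=> [t [/andP[t0 t1] ->]]; exists (1 - t); split.
  by apply/andP; split; lra.
by congr (_, _); ring.
Qed.

(** [det3 P Q] is affine in its third argument and vanishes on the line through [P] and [Q], in
    particular at [X]. *)
Lemma in_segment_det3 (R : realType) (P Q S T X : R * R) :
  in_segment P Q X -> in_segment S T X ->
  exists t : R, [/\ 0 <= t <= 1, (1 - t) * det3 P Q S + t * det3 P Q T = 0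
    & X = ((1 - t) * S.1 + t * T.1, (1 - t) * S.2 + t * T.2)].
Proof.
move=> [s [_ XPQ]] [t [t01 XST]]; exists t; split=> //.
transitivity (det3 P Q X); first by rewrite XST /det3 /=; ring.
by rewrite XPQ /det3 /=; ring.
Qed.

Lemma in_segment_common (R : realType) (P Q T X : R * R) :
  det3 P Q T != 0 -> in_segment P Q X -> in_segment P T X -> X = P.
Proof.
move=> d0 hQ hT; have [t [_ h ->]] := in_segment_det3 hQ hT.
have {h} : t * det3 P Q T = 0 by rewrite -h /det3; ring.
move/eqP; rewrite mulf_eq0 (negPf d0) orbF => /eqP->.
by rewrite subr0 !mul1r !mul0r !addr0; case: P {d0 hQ hT}.
Qed.

(** An affine function with the same strict sign at both ends of a segment has no zero on it. *)
Lemma in_segment_opposite (R : realType) (P Q S T X : R * R) :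
  in_segment P Q X -> in_segment S T X ->
  det3 P Q S != 0 -> det3 P Q T != 0 ->
  (0 < det3 P Q S) != (0 < det3 P Q T).
Proof.
move=> hPQ hST; have [t [/andP[t0 t1] h _]] := in_segment_det3 hPQ hST.
move: h; set a := det3 P Q S; set b := det3 P Q T => h.
case: (ltgtP a 0) => //; case: (ltgtP b 0) => // hb ha _ _; exfalso.
all: nra.
Qed.

(** * The three bent arms and their orientations *)

(* The linear map of order 3 sending (1,0) to (0,1) to (-1,-1) to (1,0). *)
Definition turn (R : realType) (P : R * R) : R * R := (- P.2, P.1 - P.2).

(** For large [N] the parabola is almost a straight ray; its convexity is the bend. *)
Definition arm_point (R : realType) (N : R) (a : nat) (t : R) : R * R :=
  iter a (@turn R) (N * t, t ^+ 2).

Lemma arm_point3 (R : realType) (N : R) (a : nat) (t : R) :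
  arm_point N a.+3 t = arm_point N a t.
Proof.
rewrite /arm_point 3!iterS; case: (iter a _ _) => x y.
by rewrite /turn /=; congr (_, _); ring.
Qed.

(** [turn] is linear of determinant 1, so orientations need computing only with first arm 0. *)
Lemma det3_turn (R : realType) (a : nat) (P Q S : R * R) :
  det3 (iter a (@turn R) P) (iter a (@turn R) Q) (iter a (@turn R) S) =
  det3 P Q S.
Proof.
elim: a => // a <- /=.
by rewrite /det3 /turn /=; ring.
Qed.

Lemma det3_same_arm (R : realType) (N : R) (a : nat) (s t r : R) :
  0 < N -> s < t -> t < r ->
  0 < det3 (arm_point N a s) (arm_point N a t) (arm_point N a r).
Proof.
move=> N0 st tr; rewrite det3_turn.
have -> : det3 (N * s, s ^+ 2) (N * t, t ^+ 2) (N * r, r ^+ 2)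
   = N * ((t - s) * (r - s) * (r - t)) by rewrite /det3 /=; ring.
by rewrite !mulr_gt0 // subr_gt0 // (lt_trans st).
Qed.

(** Looking outwards along a chord of an arm, the next arm is on the left. In [det3_prev_arm] the
    chord is traversed inwards ([t < s]), so the previous arm is on its right looking outwards. *)
Lemma det3_next_arm (R : realType) (N : R) (a : nat) (s t r : R) :
  1 <= s -> 1 <= r -> s < t -> r <= N ->
  0 < det3 (arm_point N a s) (arm_point N a t) (arm_point N a.+1 r).
Proof.
move=> s1 r1 st rN; rewrite /arm_point iterSr det3_turn.
have -> : det3 (N * s, s ^+ 2) (N * t, t ^+ 2) (turn (N * r, r ^+ 2))
  = (t - s) * (N * r * (N - r) + N * (s * t) + (s + t) * r ^+ 2).
  by rewrite /det3 /turn /=; ring.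
have N0 : 0 < N by lra.
apply: mulr_gt0; first lra.
rewrite ltr_wpDl ?mulr_gt0 ?exprn_gt0 //; try lra.
by rewrite addr_ge0 // !mulr_ge0 //; lra.
Qed.

Lemma det3_prev_arm (R : realType) (N : R) (a : nat) (s t r : R) :
  1 <= s -> 1 <= r -> t < s -> 1 <= t -> (s + 1) * (t + 1) <= N ->
  0 < det3 (arm_point N a s) (arm_point N a t) (arm_point N a.+2 r).
Proof.
move=> s1 r1 ts t1 hN; rewrite /arm_point 2!iterSr det3_turn.
(* The factor after [N] is [N * r - (s + t) * r - s * t], regrouped into terms that are visibly
   nonnegative. *)
have -> : det3 (N * s, s ^+ 2) (N * t, t ^+ 2) (turn (turn (N * r, r ^+ 2)))
  = (s - t) * (N * ((N - (s + 1) * (t + 1)) * r + s * t * (r - 1) + r)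
    + (s + t) * r ^+ 2).
  by rewrite /det3 /turn /=; ring.
have N0 : 0 < N by apply: lt_le_trans hN; rewrite mulr_gt0 //; lra.
apply: mulr_gt0; first lra.
rewrite ltr_wpDl ?mulr_gt0 ?exprn_gt0 //; try lra.
rewrite mulr_ge0 ?(ltW N0) // !addr_ge0 // ?mulr_ge0 //; lra.
Qed.

(** The three summands are the cross products of cyclically consecutive vertices, each positive: the
    triangle winds around the origin. *)
Lemma det3_three_arms (R : realType) (N : R) (a : nat) (s t r : R) :
  1 <= s -> 1 <= t -> 1 <= r -> s <= N -> t <= N -> r <= N ->
  0 < det3 (arm_point N a s) (arm_point N a.+1 t) (arm_point N a.+2 r).
Proof.
move=> s1 t1 r1 sN tN rN; rewrite /arm_point (iterSr a.+1) !(iterSr a) det3_turn.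
have -> : det3 (N * s, s ^+ 2) (turn (N * t, t ^+ 2)) (turn (turn (N * r, r ^+ 2)))
  = (N * s * t * (N - t) + (s * t) ^+ 2) + (N * t * r * (N - r) + (t * r) ^+ 2)
    + (N * r * s * (N - s) + (r * s) ^+ 2).
  by rewrite /det3 /turn /=; ring.
have N0 : 0 < N by lra.
have pos u v : 1 <= u -> 1 <= v -> v <= N ->
    0 < N * u * v * (N - v) + (u * v) ^+ 2.
  move=> u1 v1 vN; rewrite ltr_wpDl ?exprn_gt0 ?mulr_gt0 ?mulr_ge0 //; lra.
by apply: addr_gt0; [apply: addr_gt0|]; apply: pos.
Qed.

(** * Orientation and crossing in terms of arms and ranks *)

(* The sign of the orientation of the vertices of ranks x, y, z on arms a, b, c. *)
Definition ccw (a x b y c z : nat) : bool :=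
  if a == b then
    if b == c then (x < y)%N (+) (x < z)%N (+) (y < z)%N
    else if c == (a.+1 %% 3)%N then (x < y)%N else (y < x)%N
  else if b == c then if a == (b.+1 %% 3)%N then (y < z)%N else (z < y)%N
  else if c == a then if b == (c.+1 %% 3)%N then (z < x)%N else (x < z)%N
  else b == (a.+1 %% 3)%N.

Lemma ccw_swap (a x b y c z : nat) : (a < 3)%N -> (b < 3)%N -> (c < 3)%N ->
  (a == b -> x != y) -> (b == c -> y != z) -> (a == c -> x != z) ->
  ccw b y a x c z = ~~ ccw a x b y c z.
Proof.
case: a => [|[|[|//]]] _; case: b => [|[|[|//]]] _; case: c => [|[|[|//]]] _;
 rewrite /ccw /=; lia.
Qed.

(** The chord has the next arm and the vertices beyond it on its left, the previous arm and the
    vertices between on its right. Edges from the previous arm to the left side are excluded because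
    their lines leave both ends of the chord on one side. *)
Lemma cross_same_arm (a x y c z d w : nat) :
  (a < 3)%N -> (c < 3)%N -> (d < 3)%N -> x != y ->
  (c == a -> (z != x) && (z != y)) -> (d == a -> (w != x) && (w != y)) ->
  (c == d -> z != w) ->
  ccw a x a y c z != ccw a x a y d w -> ccw c z d w a x != ccw c z d w a y ->
  let between k := (minn x y < k < maxn x y)%N in
  let beyond k := (k < minn x y)%N || (maxn x y < k)%N in
  [&& c == a, between z & (d == (a.+1 %% 3)%N) || ((d == a) && beyond w)] ||
  [&& d == a, between w & (c == (a.+1 %% 3)%N) || ((c == a) && beyond z)].
Proof.
case: a => [|[|[|//]]] _; case: c => [|[|[|//]]] _; case: d => [|[|[|//]]] _;
 rewrite /ccw /=; lia.
Qed.

(** The line of the edge separates the higher ranks of both arms from their lower ranks and the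
    third arm. Lines of edges from the third arm leave both ends on one side, and so do chords of
    arm [b] spanning [y], since arm [a] precedes [b]. *)
Lemma cross_next_arm (a x y c z d w : nat) :
  (a < 3)%N -> (c < 3)%N -> (d < 3)%N -> let b := (a.+1 %% 3)%N in
  (c == a -> z != x) -> (d == a -> w != x) ->
  (c == b -> z != y) -> (d == b -> w != y) ->
  (c == d -> z != w) ->
  ccw a x b y c z != ccw a x b y d w -> ccw c z d w a x != ccw c z d w b y ->
  [|| [&& c == a, d == b & ((z < x) && (y < w)) || ((x < z) && (w < y))]
    , [&& d == a, c == b & ((w < x) && (y < z)) || ((x < w) && (z < y))]
    | [&& c == a, d == a & ((z < x) && (x < w)) || ((w < x) && (x < z))]]%N.
Proof.
case: a => [|[|[|//]]] _; case: c => [|[|[|//]]] _; case: d => [|[|[|//]]] _;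
 rewrite /ccw /=; lia.
Qed.

Lemma arm_point_mod (R : realType) (N : R) (a : nat) (t : R) :
  arm_point N (a %% 3) t = arm_point N a t.
Proof.
rewrite {2}(divn_eq a 3); elim: (a %/ 3)%N => [|q ->] //.
by rewrite mulSn -addnA !addSn add0n arm_point3.
Qed.

Lemma ccw_det3 (R : realType) (n a x b y c z : nat) :
  let N : R := (n.+1 ^ 2)%:R in let p k u := arm_point N k u.+1%:R in
  (a < 3)%N -> (b < 3)%N -> (c < 3)%N -> (x < n)%N -> (y < n)%N -> (z < n)%N ->
  (a == b -> x != y) -> (b == c -> y != z) -> (a == c -> x != z) ->
  ccw a x b y c z -> 0 < det3 (p a x) (p b y) (p c z).
Proof.
move=> N p.
have ge1 u : 1 <= u.+1%:R :> R by rewrite ler1n.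
have leN u : (u < n)%N -> u.+1%:R <= N.
  by move=> un; rewrite ler_nat; nia.
have mulN u v : (u < n)%N -> (v < n)%N -> (u.+1%:R + 1) * (v.+1%:R + 1) <= N.
  by move=> un vn; rewrite !natr1 -natrM ler_nat; nia.
have N0 : 0 < N by rewrite ltr0n expn_gt0.
have lt_S u v : (u < v)%N -> u.+1%:R < v.+1%:R :> R by rewrite ltr_nat.
(* Two vertices on one arm and one elsewhere; the other positions of the odd vertex follow by cyclic
   rotation. *)
have pair d e u v w : (d < 3)%N -> (e < 3)%N -> e != d ->
    (u < n)%N -> (v < n)%N -> (w < n)%N ->
    (if e == d.+1 %% 3 then u < v else v < u)%N ->
    0 < det3 (p d u) (p d v) (p e w).
  move=> d3 e3 ed un vn wn; case: eqP => [->|ne] uv.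
    by rewrite /p arm_point_mod; apply: det3_next_arm; auto.
  have -> : e = (d.+2 %% 3)%N by lia.
  by rewrite /p arm_point_mod; apply: det3_prev_arm; auto.
move=> a3 b3 c3 xn yn zn; rewrite /ccw; case: (eqVneq a b) => [<-|ab].
  case: (eqVneq a c) => [<-|ac] xy yz xz; last by apply: pair; rewrite // eq_sym.
  have same u v w : (u < v)%N -> (v < w)%N -> 0 < det3 (p a u) (p a v) (p a w).
    by move=> uv vw; apply: det3_same_arm; auto.
  move=> h; have [|[|]] : (x < y < z \/ y < z < x \/ z < x < y)%N by lia.
  - by case/andP; apply: same.
  - by case/andP=> yz' zx; rewrite det3_cycle; apply: same.
  - by case/andP=> zx xy'; rewrite -det3_cycle; apply: same.
case: (eqVneq b c) => [<-|bc] xy yz xz.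
  by move=> h; rewrite det3_cycle; apply: pair.
case: (eqVneq c a) => [ca|ca].
  by rewrite ca => h; rewrite -det3_cycle; apply: pair; rewrite // eq_sym.
move=> /eqP ba.
have -> : c = (a.+2 %% 3)%N by lia.
by rewrite ba /p !arm_point_mod; apply: det3_three_arms; auto.
Qed.

(** * The drawing and its crossings *)

(* (n + 1)^2 is large enough that the bend of an arm never reaches another one:
   det3_prev_arm needs (s + 1)(t + 1) <= N. *)
Definition three_arms (R : realType) (n : nat) (i : 'I_n) : R * R :=
  arm_point (n.+1 ^ 2)%:R (i %% 3) (i %/ 3).+1%:R.

Definition vccw (i j k : nat) : bool :=
  ccw (i %% 3) (i %/ 3) (j %% 3) (j %/ 3) (k %% 3) (k %/ 3).

Lemma three_arms_det3 (R : realType) (n : nat) (i j k : 'I_n) :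
  i != j -> j != k -> i != k ->
  let d := det3 (three_arms R i) (three_arms R j) (three_arms R k) in
  d != 0 /\ (0 < d) = vccw i j k.
Proof.
rewrite -!(inj_eq val_inj) /= => ij jk ik.
have hpos (u v w : 'I_n) : u != v :> nat -> v != w :> nat -> u != w :> nat ->
    vccw u v w -> 0 < det3 (three_arms R u) (three_arms R v) (three_arms R w).
  move=> uv vw uw; have [[un vn] wn] := (ltn_ord u, ltn_ord v, ltn_ord w).
  by apply: ccw_det3; rewrite ?ltn_mod //; lia.
case: (boolP (vccw i j k)) => [h|].
  by have d0 := hpos _ _ _ ij jk ik h; rewrite d0 gt_eqF.
(* Swapping two vertices negates both sides, so the positive case [hpos] also settles the negative
   one. *)
rewrite /vccw -ccw_swap; try lia.
move/(hpos j i k); rewrite eq_sym ij ik jk det3_swap oppr_gt0 => /(_ isT isT isT) d0.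
by rewrite lt_eqF // lt_gtF.
Qed.

Lemma three_arms_drawing (R : realType) (n : nat) : (3 <= n)%N ->
  rectilinear_drawing (@three_arms R n).
Proof.
move=> n3; split=> [i j pij|i j k ij jk ik /collinear_det3 /eqP]; last first.
  by have [/negPf -> _] := @three_arms_det3 R n i j k ij jk ik.
apply/eqP; apply: contraT => ij.
(* If two vertices coincided, their determinant with any third vertex would vanish. *)
have [k] : exists k, k \notin [set i; j]%SET.
  apply/existsP; rewrite -negb_forall; apply: contraTN n3 => /forallP full.
  rewrite -ltnNge -[n]card_ord ltnS -cardsT (@leq_trans #|[set i; j]%SET|) //.
    by apply/subset_leq_card/subsetP => k _; apply: full.
  by rewrite cards2 ij.
rewrite !inE negb_or => /andP[ki kj].
have [] := @three_arms_det3 R n i j k ij; rewrite 1?eq_sym //.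
by rewrite pij /det3 !subrr !mul0r subrr eqxx.
Qed.

(** Edges sharing a vertex meet only there, by general position, and [cross] excludes a common
    endpoint. *)
Lemma three_arms_cross (R : realType) (n : nat) (i j k l : 'I_n) :
  (i < j)%N -> (k < l)%N -> cross (@three_arms R n) (i, j) (k, l) ->
  [/\ i != k, i != l, j != k & j != l] /\
  vccw i j k != vccw i j l /\ vccw k l i != vccw k l j.
Proof.
move=> ij kl [] /= ef [X [/= he hf /= hX]].
have nij : i != j by rewrite neq_ltn ij.
have nkl : k != l by rewrite neq_ltn kl.
rewrite /on_edge /= in he hf.
pose det := @three_arms_det3 R n.
have common (u v w : 'I_n) : u != v -> v != w -> u != w ->
    in_segment (three_arms R u) (three_arms R v) X ->
    in_segment (three_arms R u) (three_arms R w) X -> X = three_arms R u.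
  by move=> uv vw uw; apply: in_segment_common; have [] := det _ _ _ uv vw uw.
have he' := in_segmentC he; have hf' := in_segmentC hf.
have ik : i != k.
  apply/eqP => eik; subst k; case: (eqVneq j l) => [ejl|jl]; first by subst l.
  by apply: hX; rewrite /endpoint /= (common _ _ _ nij jl nkl he hf); split; left.
have jl : j != l.
  apply/eqP => ejl; subst l; rewrite eq_sym in nij; rewrite eq_sym in nkl.
  by apply: hX; rewrite /endpoint /= (common j i k _ ik _ he' hf')//; split; right.
have il : i != l.
  apply/eqP => eil; subst l; rewrite eq_sym in nkl.
  have jk : j != k by apply/eqP => ejk; subst k; lia.
  by apply: hX; rewrite /endpoint /= (common i j k _ jk _ he hf')//; split; [left|right].
have jk : j != k.
  apply/eqP => ejk; subst k; rewrite eq_sym in nij.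
  by apply: hX; rewrite /endpoint /= (common j i l _ il _ he' hf)//; split; [right|left].
split=> //.
have [d1 s1] := det _ _ _ nij jk ik; have [d2 s2] := det _ _ _ nij jl il.
have [d3 s3] := det k l i nkl (contra_neq esym il) (contra_neq esym ik).
have [d4 s4] := det k l j nkl (contra_neq esym jl) (contra_neq esym jk).
split; first by rewrite -s1 -s2; apply: (in_segment_opposite he hf).
by rewrite -s3 -s4; apply: (in_segment_opposite hf he).
Qed.

(** * Counting the crossings of an edge *)

Definition vcross (i j k l : nat) : bool :=
  [&& i != k, i != l, j != k, j != l,
      vccw i j k != vccw i j l & vccw k l i != vccw k l j].

Lemma vcrossC (i j k l : nat) : i != j -> k != l ->
  vcross j i k l = vcross i j k l.
Proof.
move=> ij kl; rewrite /vcross [vccw k l j == _]eq_sym.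
have swap m : i != m -> j != m -> vccw j i m = ~~ vccw i j m.
  by move=> im jm; apply: ccw_swap; rewrite ?ltn_mod //; lia.
case: (eqVneq i k) => ik; case: (eqVneq i l) => il; case: (eqVneq j k) => jk;
  case: (eqVneq j l) => jl //=.
by rewrite !swap // (inj_eq negb_inj).
Qed.

Definition ranked (n a : nat) (P : pred nat) : {set 'I_n} :=
  [set k : 'I_n | (k %% 3 == a)%N && P (k %/ 3)%N]%SET.

Lemma card_arm (n a : nat) : (a < 3)%N -> (n %/ 3 <= #|ranked n a predT|)%N.
Proof.
move=> a3; have bound (q : 'I_(n %/ 3)) : (q * 3 + a < n)%N.
  by have := ltn_ord q; lia.
rewrite -[leqLHS]card_ord -(@card_imset _ _ (fun q => Ordinal (bound q))).
  apply/subset_leq_card/subsetP => _ /imsetP[q _ ->].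
  by rewrite !inE /=; lia.
by move=> q r /(congr1 val) /= h; apply/val_inj => /=; lia.
Qed.

Lemma divmod_eq3 (k l : nat) :
  (k == l) = (k %% 3 == l %% 3)%N && (k %/ 3 == l %/ 3)%N.
Proof. lia. Qed.

Lemma cards_sum (T : finType) (A : {set T}) : #|A| = (\sum_k (k \in A))%N.
Proof. by rewrite -sum1_card big_mkcond; apply: eq_bigr => k _; case: (k \in A). Qed.

Definition sort_pair (n : nat) (e : 'I_n * 'I_n) : 'I_n * 'I_n :=
  if (e.1 < e.2)%N then e else (e.2, e.1).

(** Edges are ordered by index, but the product sets below order the ends by their role; this
    absorbs the mismatch. *)
Lemma card_sort_pair (n : nat) (A S : {set 'I_n * 'I_n}) :
  A \subset edges n ->
  (forall f, f \in A -> (f \in S) || ((f.2, f.1) \in S)) ->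
  (#|A| <= #|S|)%N.
Proof.
move=> /subsetP Ae AS; apply: leq_trans (leq_imset_card (@sort_pair n) S).
apply/subset_leq_card/subsetP => -[k l] fA.
have := Ae _ fA; rewrite inE /= => kl.
have /orP[h|h] := AS _ fA; apply/imsetP; first by exists (k, l); rewrite // /sort_pair /= kl.
by exists (l, k); rewrite // /sort_pair /= ltnNge ltnW.
Qed.

Definition vcrossers (n : nat) (i j : 'I_n) : {set 'I_n * 'I_n} :=
  [set f in edges n | vcross i j f.1 f.2]%SET.

(** [mid], [far], the two ends and the previous arm are disjoint, which bounds [#|mid| + #|far|]. *)
Lemma card_vcrossers_same (n : nat) (i j : 'I_n) :
  i != j -> (i %% 3 == j %% 3)%N ->
  (4 * #|vcrossers i j| <= (n - n %/ 3 - 2) ^ 2)%N.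
Proof.
rewrite -(inj_eq val_inj) /= => ij mij.
set a := (i %% 3)%N; set x := (i %/ 3)%N; set y := (j %/ 3)%N.
pose mid := ranked n a (fun k => minn x y < k < maxn x y)%N.
pose far := (ranked n a (fun k => (k < minn x y) || (maxn x y < k))%N
  :|: ranked n (a.+1 %% 3) predT)%SET.
have le : (#|vcrossers i j| <= #|mid| * #|far|)%N.
  rewrite -cardsX; apply: card_sort_pair => [|[k l]].
    by apply/subsetP => f; rewrite inE => /andP[].
  rewrite !inE /= => /andP[kl /and5P[ik il jk jl /andP[]]].
  rewrite /vccw -(eqP mij) -/a -/x -/y => h1 h2.
  have := @cross_same_arm a x y (k %% 3) (k %/ 3) (l %% 3) (l %/ 3).
  rewrite !ltn_mod => /(_ isT isT isT).
  have [h3 h4 h5 h6] : [/\ x != y, (k %% 3 == a)%N -> (k %/ 3 != x)%N && (k %/ 3 != y)%N,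
    (l %% 3 == a)%N -> (l %/ 3 != x)%N && (l %/ 3 != y)%N
    & (k %% 3 == l %% 3)%N -> (k %/ 3 != l %/ 3)%N] by split; lia.
  case/(_ h3 h4 h5 h6 h1 h2)/orP => /and3P[-> -> /orP[->|/andP[-> ->]]];
    by rewrite ?(andbT, orbT).
have sum : (#|mid| + #|far| + 2 + n %/ 3 <= n)%N.
  have := @card_arm n (a.+2 %% 3) (@ltn_pmod _ 3 isT).
  set prev := ranked _ _ _ => hprev.
  apply: leq_trans (_ : #|mid| + #|far| + (#|[set i]%SET| + #|[set j]%SET|)
    + #|prev| <= n)%N.
    by rewrite !cards1 leq_add2l.
  (* Disjointness is checked vertex by vertex: the indicators sum to at most 1. *)
  rewrite !cards_sum -!big_split /= -[leqRHS]card_ord -sum1_card.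
  apply: leq_sum => k _; rewrite !inE -!(inj_eq val_inj) /=.
  rewrite (divmod_eq3 k i) (divmod_eq3 k j) -(eqP mij) -/a -/x -/y.
  have a3 : (a < 3)%N by rewrite ltn_mod.
  have xy : x != y by move: ij; rewrite divmod_eq3 mij.
  by move: (k %% 3)%N (k %/ 3)%N; clearbody a x y => ka kx; lia.
apply: leq_trans (_ : (#|mid| + #|far|) ^ 2 <= _)%N; last by rewrite leq_exp2r //; lia.
by apply: leq_trans (nat_AGM2 _ _); rewrite leq_mul2l.
Qed.

Lemma card_vcrossers_next (n : nat) (i j : 'I_n) :
  (j %% 3 == (i %% 3).+1 %% 3)%N ->
  (4 * #|vcrossers i j| <= (n - n %/ 3 - 2) ^ 2)%N.
Proof.
move=> mij; set a := (i %% 3)%N; set b := (a.+1 %% 3)%N.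
set x := (i %/ 3)%N; set y := (j %/ 3)%N.
pose loA := ranked n a (fun k => k < x)%N; pose hiA := ranked n a (fun k => x < k)%N.
pose loB := ranked n b (fun k => k < y)%N; pose hiB := ranked n b (fun k => y < k)%N.
have le : (#|vcrossers i j| <= #|loA| * #|hiB| + #|hiA| * #|loB| + #|loA| * #|hiA|)%N.
  rewrite -!cardsX.
  apply: leq_trans (_ : #|setX loA hiB :|: setX hiA loB :|: setX loA hiA| <= _)%N.
    apply: card_sort_pair => [|[k l]].
      by apply/subsetP => f; rewrite inE => /andP[].
    rewrite !inE /= => /andP[kl /and5P[ik il jk jl /andP[]]].
    rewrite /vccw (eqP mij) -/a -/b -/x -/y => h1 h2.
    have := @cross_next_arm a x y (k %% 3) (k %/ 3) (l %% 3) (l %/ 3).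
    rewrite !ltn_mod => /(_ isT isT isT) /=; rewrite -/b.
    have [h3 h4] : ((k %% 3 == a)%N -> (k %/ 3 != x)%N) /\
      ((l %% 3 == a)%N -> (l %/ 3 != x)%N) by split; lia.
    have [h5 h6 h7] : [/\ (k %% 3 == b)%N -> (k %/ 3 != y)%N,
      (l %% 3 == b)%N -> (l %/ 3 != y)%N &
      (k %% 3 == l %% 3)%N -> (k %/ 3 != l %/ 3)%N] by split; lia.
    by case/(_ h3 h4 h5 h6 h7 h1 h2)/or3P => /and3P[-> ->] /orP[]/andP[-> ->];
      rewrite ?(andbT, orbT).
  apply: leq_trans (leq_card_setU _ _) _; rewrite leq_add2r.
  exact: leq_card_setU.
have sum : (#|loA| + #|hiA| + #|loB| + #|hiB| + 2 + n %/ 3 <= n)%N.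
  have := @card_arm n (a.+2 %% 3) (@ltn_pmod _ 3 isT).
  set prev := ranked _ _ _ => hprev.
  apply: leq_trans (_ : #|loA| + #|hiA| + #|loB| + #|hiB|
    + (#|[set i]%SET| + #|[set j]%SET|) + #|prev| <= n)%N.
    by rewrite !cards1 leq_add2l.
  rewrite !cards_sum -!big_split /= -[leqRHS]card_ord -sum1_card.
  apply: leq_sum => k _; rewrite !inE -!(inj_eq val_inj) /=.
  rewrite (divmod_eq3 k i) (divmod_eq3 k j) (eqP mij) -/a -/b -/x -/y.
  have a3 : (a < 3)%N by rewrite ltn_mod.
  by rewrite /b; move: (k %% 3)%N (k %/ 3)%N; clearbody a x y => ka kx; lia.
move: le sum; set lA := #|loA|; set hA := #|hiA|; set lB := #|loB|; set hB := #|hiB|.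
move=> le sum.
have amgm : (4 * (lA * hB + hA * lB + lA * hA) <= (lA + hA + lB + hB) ^ 2)%N.
  (* RHS - LHS = (lA - hA + lB - hB)^2 + 4 lB hB. *)
  have := sqr_ge0 (lA%:Z - hA%:Z + lB%:Z - hB%:Z); nia.
apply: leq_trans (_ : (lA + hA + lB + hB) ^ 2 <= _)%N; first by lia.
by rewrite leq_exp2r //; lia.
Qed.

Lemma card_vcrossers (n : nat) (i j : 'I_n) : i != j ->
  (4 * #|vcrossers i j| <= (n - n %/ 3 - 2) ^ 2)%N.
Proof.
move=> ij; have [e|ne] := eqVneq (i %% 3)%N (j %% 3)%N.
  by apply: card_vcrossers_same; rewrite ?e.
have [h|h] := eqVneq (j %% 3)%N ((i %% 3).+1 %% 3)%N.
  by apply: card_vcrossers_next; rewrite h.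
(* Otherwise the arm of [i] follows that of [j], so the ends are exchanged. *)
have -> : vcrossers i j = vcrossers j i.
  apply/setP => -[k l]; rewrite !inE /=; case: (ltnP k l) => //= kl.
  by rewrite vcrossC //; rewrite -?(inj_eq val_inj) /= in ij *; lia.
by apply: card_vcrossers_next; lia.
Qed.

(** * The bound on the local crossing number *)

Lemma lcr_three_arms (R : realType) (n : nat) :
  (4 * local_crossing_number (@three_arms R n) <= (n - n %/ 3 - 2) ^ 2)%N.
Proof.
rewrite /local_crossing_number mulnC -leq_divRL //.
apply/bigmax_leqP => -[i j]; rewrite inE /= => ij; rewrite leq_divRL // mulnC.
apply: leq_trans (@card_vcrossers n i j _); last by rewrite neq_ltn ij.
rewrite leq_mul2l /=; apply/subset_leq_card/subsetP => -[k l].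
rewrite !inE /= => /andP[kl /asboolP /(three_arms_cross ij kl)].
by move=> [[ik il jk jl] [h1 h2]]; rewrite kl /vcross !val_eqE ik il jk jl h1 h2.
Qed.

Theorem theorem4 (R : realType) (n : nat) (hn : (3 <= n)%N) :
  (rectilinear_lcr R n)%:R <=
    (if (n %% 3 == 0)%N then 1 / 9 * (n%:R - 3) ^+ 2
     else if (n %% 3 == 1)%N then 1 / 9 * ((n%:R - 1) * (n%:R - 4))
     else 1 / 9 * (n%:R - 2) ^+ 2) :> rat.
Proof.
have : (4 * rectilinear_lcr R n <= (n - n %/ 3 - 2) ^ 2)%N.
  apply: leq_trans (lcr_three_arms R n); rewrite leq_mul2l /= /rectilinear_lcr.
  case: ex_minnP => c _; apply; apply/asboolP.
  by exists (@three_arms R n); split; first exact: three_arms_drawing.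
move: (rectilinear_lcr R n) => c; rewrite {1}(divn_eq n 3).
(* The bound becomes [4 * c <= (2 * m + r - 2) ^ 2]; [0 < m] keeps the subtraction from
   truncating. *)
have [m m0 [r r3 ->]] : exists2 m, (0 < m)%N & exists2 r, (r < 3)%N & n = (m * 3 + r)%N.
  by exists (n %/ 3)%N; [lia | exists (n %% 3)%N; lia].
rewrite -divn_eq modnMDl divnMDl // (modn_small r3) (divn_small r3) addn0.
case: r r3 => [|[|[|//]]] _ le /=.
- have {}le : (c <= (m - 1) ^ 2)%N by nia.
  have -> : 1 / 9 * ((m * 3 + 0)%:R - 3) ^+ 2 = ((m - 1) ^ 2)%:R :> rat.
    by rewrite natrX natrB // addn0 natrM; field.
  by rewrite ler_nat.
(* Here [(2 * m - 1) ^ 2 = 4 * m * (m - 1) + 1], and integrality of [c] removes the extra 1. *)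
- have {}le : (c <= m * (m - 1))%N by nia.
  have -> : 1 / 9 * (((m * 3 + 1)%:R - 1) * ((m * 3 + 1)%:R - 4))
      = (m * (m - 1))%:R :> rat.
    by rewrite natrM natrB // natrD natrM; field.
  by rewrite ler_nat.
- have {}le : (c <= m ^ 2)%N by nia.
  have -> : 1 / 9 * ((m * 3 + 2)%:R - 2) ^+ 2 = (m ^ 2)%:R :> rat.
    by rewrite natrX natrD natrM; field.
  by rewrite ler_nat.
Qed.
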